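(* Let $I\subset\mathbb C[\mathbf x,\mathbf p]$ be an ideal and let $J=\langle h\rangle\subset\mathbb C[\mathbf x,\mathbf p]$ be a principal ideal such that $(I:J^\infty)\cap\mathbb C[\mathbf p]=\{0\}$. Let $G=\{g_1,\ldots,g_s\}$ be a Gröbner basis of $I:J^\infty$ relative to the lex order with $x_1>\cdots>x_n>p_1>\cdots>p_k$. Then there is a proper subvariety $\Delta\subsetneq\mathbb C^k$ such that for all $\mathbf q\in\mathbb C^k\setminus\Delta$ the set $\{\phi_{\mathbf q}(g_1),\ldots,\phi_{\mathbf q}(g_s)\}$ is a Gröbner basis for $\phi_{\mathbf q}(I):\phi_{\mathbf q}(J)^\infty$, and none of the leading terms of $g_1,\ldots,g_s$ vanish when evaluated at $\mathbf q$. In particular, $\phi_{\mathbf q}(I:J^\infty)=\phi_{\mathbf q}(I):\phi_{\mathbf q}(J)^\infty$ for all $\mathbf q\in\mathbb C^k\setminus\Delta$.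
   Context: $\mathbb C[\mathbf x,\mathbf p]=\mathbb C[x_1,\ldots,x_n,p_1,\ldots,p_k]$, $\mathbb C[\mathbf x]=\mathbb C[x_1,\ldots,x_n]$, $\mathbb C[\mathbf p]=\mathbb C[p_1,\ldots,p_k]$. For $\mathbf q\in\mathbb C^k$, $\phi_{\mathbf q}:\mathbb C[\mathbf x,\mathbf p]\to\mathbb C[\mathbf x]$, $f(\mathbf x;\mathbf p)\mapsto f(\mathbf x;\mathbf q)$, is the surjective evaluation ring homomorphism; for an ideal $L\subset\mathbb C[\mathbf x,\mathbf p]$, $\phi_{\mathbf q}(L)$ denotes its image, an ideal of $\mathbb C[\mathbf x]$. The saturation of an ideal $I$ by a principal ideal $J=\langle h\rangle$ in a polynomial ring $R$ is $I:J^\infty:=\{f\in R\mid \exists\,\ell>0:\ f\cdot h^\ell\in I\}$. It is taken in $R=\mathbb C[\mathbf x,\mathbf p]$ for $I:J^\infty$, and in $R=\mathbb C[\mathbf x]$ for $\phi_{\mathbf q}(I):\phi_{\mathbf q}(J)^\infty$, where $\phi_{\mathbf q}(J)=\langle\phi_{\mathbf q}(h)\rangle$. Gröbner bases in $\mathbb C[\mathbf x]$ are taken relative to the lex order with $x_1>\cdots>x_n$. Elements of Gröbner bases are nonzero by convention. Leading terms of the $g_i$ are understood with respect to the variables $\mathbf x$: each $g_i\notin\mathbb C[\mathbf p]$ is written as $g_i=c_i(\mathbf p)\mathbf x^{\alpha_i}+h_i$ with $0\neq c_i\in\mathbb C[\mathbf p]$, where all terms of $h_i$ are strictly smaller than $\mathbf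 x^{\alpha_i}$ in the lex order. The leading term of $g_i$ is $c_i(\mathbf p)\mathbf x^{\alpha_i}$, and it does not vanish when evaluated at $\mathbf q$ if $c_i(\mathbf q)\neq 0$. A subvariety of $\mathbb C^k$ is the common zero set of a set of polynomials in $\mathbb C[\mathbf p]$ (not necessarily irreducible, possibly empty). *)

(* Defs.v *)
From mathcomp Require Import all_boot all_order all_algebra.
From mathcomp Require Export complex.
From mathcomp Require Export classical_sets reals.
From mathcomp Require Export mpoly.

Set Implicit Arguments.
Unset Strict Implicit.
Unset Printing Implicit Defensive.

Import Order.TTheory GRing.Theory.

Local Open Scope classical_set_scope.
Local Open Scope ring_scope.

(* [ring_quotient.idealr_closed] only describes proper ideals given by boolean
   predicates, whereas the unit ideal must be allowed here. *)
Definition is_ideal (R : comNzRingType) (I : set R) : Prop :=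
  [/\ I 0,
      forall f g, I f -> I g -> I (f + g) &
      forall a f, I f -> I (a * f)].

Definition ideal_gen (R : comNzRingType) (S : set R) : set R :=
  [set f | forall I, is_ideal I -> S `<=` I -> I f].

(* I : <h>^oo, expressed through the generator h *)
Definition saturation (R : comNzRingType) (I : set R) (h : R) : set R :=
  [set f | exists l : nat, (0 < l)%N /\ I (f * h ^+ l)].

Section Lex.
Variable n : nat.

(* The order that [mpoly] puts on monomials is graded, hence is not used.
   Exponent vectors are compared by their first differing entry, so that
   'X_i > 'X_j whenever i < j. *)
Definition mlex_lt (m1 m2 : 'X_{1..n}) : bool :=
  ((m1 : seq nat) < (m2 : seq nat) :> seqlexi nat)%O.

Definition mlex_max (m1 m2 : 'X_{1..n}) : 'X_{1..n} :=
  if mlex_lt m1 m2 then m2 else m1.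

Variable F : fieldType.

(* 0 is the least monomial; lex_lead 0 is the junk value 0. *)
Definition lex_lead (f : {mpoly F[n]}) : 'X_{1..n} :=
  \big[mlex_max/0%MM]_(m <- msupp f) m.

Definition lex_lead_term (f : {mpoly F[n]}) : {mpoly F[n]} :=
  f@_(lex_lead f) *: 'X_[lex_lead f].

Definition is_groebner (L : set {mpoly F[n]}) (G : seq {mpoly F[n]}) : Prop :=
  (forall g, g \in G -> L g /\ g != 0) /\
  ideal_gen (lex_lead_term @` [set` G]) =
  ideal_gen (lex_lead_term @` (L `\ 0)).

End Lex.

(* F[x_1..x_n, p_1..p_k] is {mpoly F[n + k]}: x_i is 'X_(lshift k i) and
   p_j is 'X_(rshift n j). *)
Section Specialization.
Variables (F : fieldType) (n k : nat).

Definition spec (q : 'I_k -> F) (f : {mpoly F[n + k]}) : {mpoly F[n]} :=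
  mmap (@mpolyC n F)
    (fun i => match split i with inl j => 'X_j | inr j => (q j)%:MP end) f.

Definition param_emb (c : {mpoly F[k]}) : {mpoly F[n + k]} :=
  mmap (@mpolyC (n + k) F) (fun j => 'X_(rshift n j)) c.

Definition xmon (a : 'X_{1..n}) : 'X_{1..n + k} :=
  [multinom match split i with inl j => a j | inr _ => 0%N end | i < n + k].

(* c(p) x^a is the leading term of g with respect to the variables x. *)
Definition is_xlead (g : {mpoly F[n + k]}) (c : {mpoly F[k]})
    (a : 'X_{1..n}) : Prop :=
  c != 0 /\
  exists r : {mpoly F[n + k]},
    g = param_emb c * 'X_[xmon a] + r /\
    forall m, m \in msupp r -> mlex_lt m (xmon a).

Definition is_subvariety (D : set ('I_k -> F)) : Prop :=
  exists S : set {mpoly F[k]},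
    D = [set q | forall f, S f -> f.@[q] = 0].

End Specialization.

(* Main.v *)
Require Import Defs.
From HB Require Import structures.
From mathcomp Require Import all_boot all_order all_algebra.
From mathcomp Require Import complex.
From mathcomp Require Import boolp classical_sets reals.
From mathcomp Require Import mpoly.

Set Implicit Arguments.
Unset Strict Implicit.
Unset Printing Implicit Defensive.

Import Order.TTheory GRing.Theory.

Local Open Scope classical_set_scope.
Local Open Scope ring_scope.

(** Write A for the ring of polynomials in the parameters p and S for the
    saturation of I by h. A polynomial in x and p is regarded as a polynomial in x
    over the domain A ([xpoly]), and specialization at q becomes evaluation of its
    coefficients at q ([spec_xpoly]).

    Commutation of saturation and specialization. Since S is saturated,
    multiplication by h is injective modulo S, and this is shown to persist at a
    generic q ([generic_saturation]). Let T = S + <h>. By Dickson's lemma ([dickson])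
    the leading monomials of T, with respect to x, are generated by those of finitely
    many members of T; let c in A be the product of their leading coefficients. If
    f * h specializes at q to a member of the specialization of S, then f * h = s + w
    with s in S and every coefficient of w vanishing at q. As w lies in T,
    pseudo-division gives c ^ l * w = s' + h * b with s' in S, and the coefficients
    of b, being sums of multiples of those of w, vanish at q too
    ([generic_division]). Hence h * (c ^ l * f - b) lies in S, so
    c ^ l * f - b lies in S, and where c does not vanish the specialization of f
    lies in that of S.

    Groebner bases. A Groebner basis of S for the lex order with x > p has leading
    monomials in x which divide those of every member of S. Where no leading
    coefficient vanishes, this passes to the specializations: a member of S whose
    leading coefficient vanishes at q can be pseudo-reduced to one with the same
    specialization up to a unit and a smaller leading monomial
    ([specialized_leads]).

    The exceptional set is the zero set of the product of c and of the leading
    coefficients of the basis. It is proper because a nonzero polynomial over an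
    infinite field has a point where it does not vanish ([mpoly_nonroot]). *)

(** * Monomials: the lexicographic order and Dickson's lemma *)

Section Monomials.
Variable n : nat.
Implicit Types (m : 'X_{1..n}) (E : set 'X_{1..n}).

Lemma mlex_ltP m1 m2 :
  reflect (exists2 i : 'I_n, forall j : 'I_n, (j < i)%N -> m1 j = m2 j
                           & (m1 i < m2 i)%N)
          (mlex_lt m1 m2).
Proof. exact: (@Order.TupleLexiOrder.ltxi_tuplePlt _ _ _ _ m1 m2). Qed.

Lemma mlex_lt_irr m : mlex_lt m m = false.
Proof. exact: ltxx. Qed.

Lemma mlex_lt_trans m2 m1 m3 : mlex_lt m1 m2 -> mlex_lt m2 m3 -> mlex_lt m1 m3.
Proof. exact: lt_trans. Qed.

Lemma mlex_total m1 m2 : [\/ mlex_lt m1 m2, m1 = m2 | mlex_lt m2 m1].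
Proof.
case: (ltgtP (m1 : seqlexi nat) (m2 : seqlexi nat)) => [lt12|lt21|/val_inj/val_inj->].
- by constructor 1.
- by constructor 3.
- by constructor 2.
Qed.

Lemma mlex_ltD m m1 m2 : mlex_lt m1 m2 -> mlex_lt (m + m1) (m + m2).
Proof.
case/mlex_ltP=> i eqm ltm; apply/mlex_ltP; exists i => [j /eqm|].
  by rewrite !mnmDE => ->.
by rewrite !mnmDE ltn_add2l.
Qed.

Lemma lem_mlex m1 m2 : (m1 <= m2)%MM -> m1 = m2 \/ mlex_lt m1 m2.
Proof.
move=> /mnm_lepP le12;
case: (mlex_total m1 m2) => [|->|/mlex_ltP[i _]]; [by right|by left|].
by rewrite ltnNge le12.
Qed.

(** Dickson's lemma for the order that compares only the first [k] exponents. *)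
Lemma dickson_prefix k E : exists s : seq 'X_{1..n},
  (forall b, b \in s -> E b) /\
  (forall m, E m -> exists2 b, b \in s &
     forall i : 'I_n, (i < k)%N -> (b i <= m i)%N).
Proof.
elim: k E => [|k IHk] E.
  have [[m0 Em0]|E0] := pselect (exists m, E m).
    by exists [:: m0]; split=> [b|m _]; [rewrite inE => /eqP->|exists m0; rewrite ?inE].
  by exists [::]; split=> // m Em; case: E0; exists m.
have [ltkn|lenk] := ltnP k n; last first.
  have [s [sE sP]] := IHk E; exists s; split=> // m /sP[b bs bm]; exists b => // i _.
  exact/bm/leq_trans/lenk.
pose o := Ordinal ltkn.
(* The elements of E whose exponent at k is bounded form finitely many slices,
   to which the induction hypothesis applies. *)
have slices N : exists s : seq 'X_{1..n},
    (forall b, b \in s -> E b) /\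
    (forall m, E m -> (m o < N)%N -> exists2 b, b \in s &
       forall i : 'I_n, (i < k.+1)%N -> (b i <= m i)%N).
  elim: N => [|N [s [sE sP]]]; first by exists [::].
  have [t [tE tP]] := IHk [set m | E m /\ m o = N].
  exists (s ++ t); split=> [b|m Em]; first by rewrite mem_cat => /orP[/sE|/tE[]].
  rewrite ltnS leq_eqVlt => /orP[/eqP mN|/(sP _ Em)[b bs bm]]; last first.
    by exists b; rewrite ?mem_cat ?bs.
  have [b bt bm] := tP _ (conj Em mN); exists b; first by rewrite mem_cat bt orbT.
  move=> i; rewrite ltnS leq_eqVlt => /orP[/eqP ik|/bm//].
  have -> : i = o by apply: val_inj.
  by have [_ ->] := tE _ bt; rewrite mN.
(* A member of E that dominates some b of s at the exponents before k, but not at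
   k, has at k an exponent smaller than the maximum below. *)
have [s [sE sP]] := IHk E; have [t [tE tP]] := slices (\max_(b <- s) b o).
exists (s ++ t); split=> [b|m Em]; first by rewrite mem_cat => /orP[/sE|/tE].
have [b bs bm] := sP _ Em; have [lebm|ltmb] := leqP (b o) (m o).
  exists b; rewrite ?mem_cat ?bs // => i; rewrite ltnS leq_eqVlt => /orP[/eqP ik|/bm//].
  by have -> : i = o by apply: val_inj.
have [|c ct cm] := tP _ Em; last by exists c; rewrite ?mem_cat ?ct ?orbT.
apply: leq_trans ltmb _; exact: (@leq_bigmax_seq _ s xpredT (fun b : 'X_{1..n} => b o)).
Qed.

(** Dickson's lemma. *)
Lemma dickson E : exists s : seq 'X_{1..n},
  (forall b, b \in s -> E b) /\
  (forall m, E m -> exists2 b, b \in s & (b <= m)%MM).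
Proof.
have [s [sE sP]] := dickson_prefix n E; exists s; split=> // m /sP[b bs bm].
by exists b => //; apply/mnm_lepP=> i; apply: bm.
Qed.

Lemma mlex_min_seq (s : seq 'X_{1..n}) : s != [::] ->
  exists2 b, b \in s & forall m, m \in s -> ~~ mlex_lt m b.
Proof.
elim: s => // a s IHs _; have [->|/IHs[b bs bmin]] := eqVneq s [::].
  by exists a; rewrite ?inE// => m; rewrite inE => /eqP->; rewrite mlex_lt_irr.
have [ab|ab] := boolP (mlex_lt a b); [exists a|exists b].
- by rewrite inE eqxx.
- move=> m; rewrite inE => /predU1P[->|/bmin]; first by rewrite mlex_lt_irr.
  by apply: contra => /mlex_lt_trans; apply.
- by rewrite inE bs orbT.
- by move=> m; rewrite inE => /predU1P[->|/bmin].
Qed.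

(** Lex is a well-order: by Dickson's lemma a set of monomials has a finite
    subset below it for divisibility, hence for lex. *)
Lemma mlex_ind (P : 'X_{1..n} -> Prop) :
  (forall m, (forall m', mlex_lt m' m -> P m') -> P m) -> forall m, P m.
Proof.
move=> IH m0; apply: contrapT => NPm0.
have [s [sE sP]] := dickson [set m | ~ P m].
have [|b bs bmin] := @mlex_min_seq s.
  by apply: contraPneq NPm0 => s0 /sP[b]; rewrite s0.
apply: (sE _ bs); apply: IH => m ltmb; apply: contrapT => /sP[c cs].
case/lem_mlex=> [cm|ltcm]; first by have := bmin _ cs; rewrite cm ltmb.
by have := bmin _ cs; rewrite (mlex_lt_trans ltcm ltmb).
Qed.

End Monomials.

(** * Leading monomials and pseudo-division *)

Section Lead.
Variable n : nat.

(** The lex leading monomial of a polynomial over any ring; the junk value at 0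
    is 0. On a field it is [lex_lead] by definition. *)
Definition lexlead (A : nzRingType) (p : {mpoly A[n]}) : 'X_{1..n} :=
  \big[@mlex_max n/0%MM]_(m <- msupp p) m.

(** The coefficient of the leading monomial. *)
Definition lexlc (A : nzRingType) (p : {mpoly A[n]}) : A := p@_(lexlead p).

Lemma mlex_max_seqP (s : seq 'X_{1..n}) M :
  M = \big[@mlex_max n/0%MM]_(m <- s) m ->
  (s != [::] -> M \in s) /\ (forall m, m \in s -> ~~ mlex_lt M m).
Proof.
elim: s M => [|a s IHs] _ ->; first by split.
rewrite big_cons; set M := (X in mlex_max a X); have [IHin IHmax] := IHs M erefl.
rewrite /mlex_max; split=> [_|m]; last first.
  case: ifP => [ltaM|leMa]; rewrite inE => /predU1P[->|/IHmax//].
  - by apply: contraT; rewrite negbK => /(mlex_lt_trans ltaM); rewrite mlex_lt_irr.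
  - by rewrite mlex_lt_irr.
  - move=> leMm; apply: contra leMm => ltam.
    case: (mlex_total a M) => [ltaM|<-//|ltMa]; first by rewrite ltaM in leMa.
    exact: mlex_lt_trans ltam.
case: ifP => [ltaM|_]; last by rewrite inE eqxx.
have [s0|/IHin Ms] := eqVneq s [::]; last by rewrite inE Ms orbT.
move: ltaM; rewrite /M s0 big_nil => /mlex_ltP[i _].
by rewrite mnm0E.
Qed.

Section Domain.
Variable A : idomainType.
Implicit Types p g : {mpoly A[n]}.

Lemma lexlead_msupp p : p != 0 -> lexlead p \in msupp p.
Proof. by rewrite -msupp_eq0 => /(mlex_max_seqP (erefl (lexlead p))).1. Qed.

Lemma lexlc_neq0 p : p != 0 -> lexlc p != 0.
Proof. by move=> /lexlead_msupp; rewrite mcoeff_msupp. Qed.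

Lemma msupp_lexlead p m : m \in msupp p -> m = lexlead p \/ mlex_lt m (lexlead p).
Proof.
move=> /(mlex_max_seqP (erefl (lexlead p))).2.
by case: (mlex_total m (lexlead p)) => [|->|->//]; [right|left].
Qed.

Lemma lexlead_eq p m : m \in msupp p ->
  (forall m', m' \in msupp p -> m' = m \/ mlex_lt m' m) -> lexlead p = m.
Proof.
move=> mp mmax; have pn0 : p != 0 by apply: contraTneq mp => ->; rewrite msupp0.
case: (mmax _ (lexlead_msupp pn0)) => // ltpm.
case: (msupp_lexlead mp) => // ltmp.
by have := mlex_lt_trans ltpm ltmp; rewrite mlex_lt_irr.
Qed.

(** One step of pseudo-division: if [c] is a multiple of the leading coefficient
    of [g], the leading monomial of [c *: p] can be cancelled by [g]. *)
Lemma pseudo_reduce p g (c d : A) : g != 0 ->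
  (lexlead g <= lexlead p)%MM -> c = d * lexlc g ->
  forall m, m \in msupp (c *: p -
                  (d * lexlc p) *: ('X_[(lexlead p - lexlead g)%MM] * g)) ->
  mlex_lt m (lexlead p).
Proof.
move=> gn0 legp cE m; set e := (lexlead p - lexlead g)%MM => mP.
have eE : (e + lexlead g)%MM = lexlead p by rewrite submK.
suff [mE|//] : m = lexlead p \/ mlex_lt m (lexlead p).
  have lcE : ('X_[e] * g)@_(lexlead p) = lexlc g by rewrite -eE mulrC mcoeffMX.
  move: mP; rewrite mcoeff_msupp mE mcoeffB !mcoeffZ lcE -/(lexlc p) cE.
  by rewrite mulrAC subrr eqxx.
have /msuppB_le := mP; rewrite mem_cat => /orP[|] /msuppZ_le.
  exact: msupp_lexlead.
rewrite mulrC (perm_mem (msuppMX _ _)) => /mapP[m' /msupp_lexlead m'g ->].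
rewrite -eE; case: m'g => [->|/(mlex_ltD e)]; by [left|right].
Qed.

End Domain.

Section Ideals.
Variable R : comNzRingType.
Implicit Types I : set R.

Lemma idealN I f : is_ideal I -> I f -> I (- f).
Proof. by case=> _ _ IM If; rewrite -mulN1r; apply: IM. Qed.

Lemma idealB I f g : is_ideal I -> I f -> I g -> I (f - g).
Proof. by move=> HI If Ig; case: (HI) => _ ID _; apply: ID => //; apply: idealN. Qed.

Lemma ideal_gen_sub I (S : set R) : S `<=` I -> is_ideal I -> ideal_gen S `<=` I.
Proof. by move=> SI HI f; apply. Qed.

Lemma ideal_gen_ideal (S : set R) : is_ideal (ideal_gen S).
Proof.
split=> [I [I0 _ _] _ //|f g Sf Sg I HI SI|a f Sf I HI SI]; case: (HI) => _ ID IM.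
  by apply: ID; [apply: Sf|apply: Sg].
by apply: IM; apply: Sf.
Qed.

Lemma sub_ideal_gen (S : set R) : S `<=` ideal_gen S.
Proof. by move=> f Sf I _; apply. Qed.

End Ideals.

Lemma idealZ (A : comNzRingType) (I : set {mpoly A[n]}) c f :
  is_ideal I -> I f -> I (c *: f).
Proof. by case=> _ _ IM If; rewrite -mul_mpolyC; apply: IM. Qed.

(** A family in [L] is a Groebner basis iff every leading monomial of [L] is
    divisible by the leading monomial of a member of the family. *)
Lemma is_groebnerP (F : fieldType) (L : set {mpoly F[n]}) (G : seq {mpoly F[n]}) :
  is_groebner L G <->
  (forall g, g \in G -> L g /\ g != 0) /\
  (forall f, L f -> f != 0 -> exists2 g, g \in G & (lexlead g <= lexlead f)%MM).
Proof.
split=> -[GL lead_eq]; split=> //; last first.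
  apply/seteqP; split; apply: ideal_gen_sub; try exact: ideal_gen_ideal.
    move=> _ [g /= gG <-]; apply: sub_ideal_gen; exists g => //.
    by have [Lg /eqP] := GL _ gG.
  move=> _ [f [Lf /eqP fn0] <-]; have [g gG legf] := lead_eq _ Lf fn0.
  have [_ gn0] := GL _ gG.
  have -> : lex_lead_term f =
      ((lexlc f / lexlc g) *: 'X_[(lexlead f - lexlead g)%MM]) * lex_lead_term g.
    rewrite /lex_lead_term -scalerAl -scalerAr scalerA -mpolyXD submK //.
    by rewrite divfK // lexlc_neq0.
  case: (ideal_gen_ideal (@lex_lead_term n F @` [set` G])) => _ _; apply.
  by apply: sub_ideal_gen; exists g.
(* The polynomials whose monomials are all divisible by a leading monomial of the
   family form an ideal. *)
pose M : set {mpoly F[n]} := [set f | forall m, m \in msupp f ->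
  exists2 g, g \in G & (lexlead g <= m)%MM].
have HM : is_ideal M.
  split=> [m|f g Mf Mg m|a f Mf m]; first by rewrite msupp0.
    by move=> /msuppD_le; rewrite mem_cat => /orP[/Mf|/Mg].
  move=> /msuppM_le /allpairsP[[m1 m2] /= [_ /Mf[g gG le_gm] ->]].
  by exists g => //; apply: lepm_trans le_gm (lem_addl _ _).
move=> f Lf fn0.
have : ideal_gen (@lex_lead_term n F @` [set` G]) (lex_lead_term f).
  by rewrite lead_eq; apply: sub_ideal_gen; exists f => //; split=> //; apply/eqP.
move=> /(_ M HM); apply.
  move=> _ [g /= gG <-] m /msuppZ_le; rewrite msuppX inE => /eqP->.
  by exists g => //; apply: lepm_refl.
by rewrite mcoeff_msupp mcoeffZ mcoeffX eqxx mulr1; apply: lexlc_neq0.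
Qed.

End Lead.

(** * Specialization of ideals at a generic point *)

Section Specialization.
Variables (n : nat) (A : idomainType).
Implicit Types (S : set {mpoly A[n]}) (f g h w : {mpoly A[n]}).

Lemma map_mpoly_coef0 (K : comNzRingType) (ev : {rmorphism A -> K}) f m :
  map_mpoly ev f = 0 -> ev f@_m = 0.
Proof. by move=> f0; rewrite -mcoeff_map_mpoly f0 mcoeff0. Qed.

Lemma lexlead_map (K : idomainType) (ev : {rmorphism A -> K}) f :
  ev (lexlc f) != 0 -> lexlead (map_mpoly ev f) = lexlead f.
Proof.
move=> lc0; apply: lexlead_eq; first by rewrite mcoeff_msupp mcoeff_map_mpoly.
move=> m; rewrite mcoeff_msupp mcoeff_map_mpoly => evm; apply: msupp_lexlead.
by rewrite mcoeff_msupp; apply: contraNneq evm => ->; rewrite raddf0.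
Qed.

Lemma map_mpoly_neq0 (K : idomainType) (ev : {rmorphism A -> K}) f :
  ev (lexlc f) != 0 -> map_mpoly ev f != 0.
Proof. by apply: contraNneq => f0; rewrite /lexlc map_mpoly_coef0. Qed.

(** If every leading monomial of [S] is divisible by one of [G], this remains so
    at every specialization that kills no leading coefficient of [G]: a member of
    [S] whose leading coefficient is killed can be replaced by one with a smaller
    leading monomial and, up to a unit, the same specialization. *)
Lemma specialized_leads S (G : seq {mpoly A[n]}) (K : fieldType)
    (ev : {rmorphism A -> K}) :
  is_ideal S -> (forall g, g \in G -> S g /\ ev (lexlc g) != 0) ->
  (forall f, S f -> f != 0 -> exists2 g, g \in G & (lexlead g <= lexlead f)%MM) ->
  forall f, S f -> map_mpoly ev f != 0 ->
  exists2 g, g \in G &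
    (lexlead (map_mpoly ev g) <= lexlead (map_mpoly ev f))%MM.
Proof.
move=> HS GS leadS f; move E : (lexlead f) => m.
elim/mlex_ind: m => m IH in f E *; move=> Sf evf.
have fn0 : f != 0 by apply: contraNneq evf => ->; rewrite raddf0.
have [g gG legf] := leadS _ Sf fn0; have [Sg evg] := GS _ gG.
have gn0 : g != 0.
  by apply: contraNneq evg => ->; rewrite /lexlc mcoeff0 raddf0.
have [evf0|evf0] := eqVneq (ev (lexlc f)) 0; last first.
  by exists g => //; rewrite !lexlead_map.
pose f' := lexlc g *: f - (1 * lexlc f) *: ('X_[(lexlead f - lexlead g)%MM] * g).
have evf' : map_mpoly ev f' = ev (lexlc g) *: map_mpoly ev f.
  by rewrite raddfB /= !map_mpolyZ mul1r evf0 scale0r subr0.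
have evf'n0 : map_mpoly ev f' != 0.
  by rewrite evf' -mul_mpolyC mulf_neq0 // mpolyC_eq0.
have f'n0 : f' != 0 by apply: contraNneq evf'n0 => ->; rewrite raddf0.
have ltf' : mlex_lt (lexlead f') m.
  rewrite -E; apply: (pseudo_reduce gn0 legf _ (lexlead_msupp f'n0)).
  by rewrite mul1r.
have Sf' : S f'.
  by apply: idealB; [|exact: idealZ|apply: idealZ => //; case: HS => _ _; apply].
have [g' g'G] := IH _ ltf' _ erefl Sf' evf'n0.
rewrite evf' => leg'; exists g' => //; congr lem: leg'.
apply: lexlead_eq => [|m']; rewrite (perm_mem (msuppZ _ evg)).
  exact: lexlead_msupp.
exact: msupp_lexlead.
Qed.

(** Pseudo-division in [T = S + <h>] by finitely many members of [T] whose leading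
    monomials generate those of [T]. Each step subtracts a member of [T] multiplied by
    a coefficient of the current dividend, so the quotient [b] and the next dividend specialize to 0
    whenever the dividend does. *)
Lemma generic_division S h : is_ideal S ->
  exists2 c : A, c != 0 & forall (K : comNzRingType) (ev : {rmorphism A -> K}) w,
    map_mpoly ev w = 0 -> (exists s b, S s /\ w = s + h * b) ->
  exists l s b, [/\ S s, c ^+ l *: w = s + h * b & map_mpoly ev b = 0].
Proof.
move=> HS; case: (HS) => S0 SD SM.
pose T : set {mpoly A[n]} := [set w | exists s b, S s /\ w = s + h * b].
have [E [ET EP]] := dickson [set m | exists t, [/\ T t, t != 0 & lexlead t = m]].
have [t tP] : exists t : 'X_{1..n} -> {mpoly A[n]},
    forall m, m \in E -> [/\ T (t m), t m != 0 & lexlead (t m) = m].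
  suff /choice[t tP] : forall m, exists t,
      m \in E -> [/\ T t, t != 0 & lexlead t = m] by exists t.
  move=> m; have [/ET[t tP]|_] := boolP (m \in E); first by exists t.
  by exists 0.
pose c := \prod_(m <- E) lexlc (t m).
exists c => [|K ev w].
  by rewrite prodf_seq_neq0; apply/allP => m /tP[_ tn0 _]; rewrite implyTb lexlc_neq0.
move Ew : (lexlead w) => m; elim/mlex_ind: m => m IH in w Ew *; move=> evw Tw.
have [->|wn0] := eqVneq w 0.
  by exists 0, 0, 0; rewrite scaler0 mulr0 addr0 raddf0.
have [e eE lee] : exists2 e, e \in E & (e <= lexlead w)%MM by apply: EP; exists w.
have [[s1 [b1 [Ss1 tE]]] tn0 leadt] := tP _ eE.
have [d cE] : exists d, c = d * lexlc (t e).
  by exists (\prod_(m <- rem e E) lexlc (t m)); rewrite mulrC /c (big_rem e).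
set X := 'X_[(lexlead w - lexlead (t e))%MM] : {mpoly A[n]}.
pose a := d * lexlc w; pose w' := c *: w - a *: (X * t e).
have evw' : map_mpoly ev w' = 0.
  rewrite raddfB /= !map_mpolyZ evw rmorphM map_mpoly_coef0 // mulr0.
  by rewrite scale0r scaler0 subrr.
have Tw' : T w'.
  case: Tw => s [b [Ss wE]]; exists (c *: s - a *: (X * s1)).
  exists (c *: b - a *: (X * b1)); split.
    by apply: idealB => //; apply: idealZ => //; apply: SM.
  rewrite /w' wE tE mulrBr !mulrDr !scalerDr -!scalerAr opprD addrACA.
  by rewrite (mulrCA X).
have [l [s [b [Ss w'E evb]]]] : exists l s b,
    [/\ S s, c ^+ l *: w' = s + h * b & map_mpoly ev b = 0].
  have [->|w'n0] := eqVneq w' 0.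
    by exists 0, 0, 0; rewrite scaler0 mulr0 addr0 raddf0.
  apply: (IH _ _ w' erefl) => //; rewrite -Ew.
  apply: (pseudo_reduce tn0 _ cE (lexlead_msupp w'n0)).
  by rewrite leadt.
exists l.+1, (s + (c ^+ l * a) *: (X * s1)), (b + (c ^+ l * a) *: (X * b1)).
split.
- by apply: SD => //; apply: idealZ => //; apply: SM.
- have -> : c ^+ l.+1 *: w = c ^+ l *: w' + (c ^+ l * a) *: (X * t e).
    by rewrite /w' scalerBr !scalerA -exprSr subrK.
  rewrite w'E tE !mulrDr scalerDr addrACA; congr (_ + (_ + _)).
  by rewrite -scalerAr (mulrCA X).
by rewrite raddfD /= evb map_mpolyZ !rmorphM (map_mpoly_coef0 _ evw) !mulr0 scale0r addr0.
Qed.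

(** Multiplication by [h] is injective modulo [S] as soon as [S : h = S]; this
    persists at a generic specialization, for powers of [h] by induction. Indeed
    if [f * h = s + w] with [s] in [S] and [w] specializing to 0, then [w] lies in
    [S + <h>], and up to a power of [c] it equals [s' + h * b] with [s'] in [S] and
    [b] specializing to 0, so that [h * (c ^+ l *: f - b)] lies in [S]. *)
Lemma generic_saturation S h : is_ideal S -> (forall f, S (h * f) -> S f) ->
  exists2 c : A, c != 0 & forall (K : fieldType) (ev : {rmorphism A -> K}),
    (forall x, exists a, ev a = x) -> ev c != 0 ->
    forall f l, (map_mpoly ev @` S) (map_mpoly ev f * map_mpoly ev h ^+ l) ->
    (map_mpoly ev @` S) (map_mpoly ev f).
Proof.
move=> HS Sh; case: (HS) => S0 SD SM.
have [c cn0 cP] := generic_division h HS; exists c => // K ev ev_surj evc f l.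
elim: l f => [|l IHl] f; first by rewrite expr0 mulr1.
rewrite exprS mulrA => -[s0 Ss0 evs0].
have {s0 Ss0 evs0} [s Ss evs] : (map_mpoly ev @` S) (map_mpoly ev (f * h)).
  by apply: (IHl (f * h)); exists s0; rewrite // evs0 rmorphM.
have [||j [s' [b [Ss' wE evb]]]] := cP K ev (f * h - s).
- by rewrite raddfB /= evs subrr.
- by exists (- s), f; split; [exact: idealN|rewrite addrC mulrC].
have Sf : S (c ^+ j *: f - b).
  apply: Sh; have -> : h * (c ^+ j *: f - b) = c ^+ j *: s + s'.
    rewrite mulrBr -scalerAr mulrC; apply/eqP; rewrite subr_eq -addrA -wE.
    by rewrite scalerBr addrC subrK.
  by apply: SD => //; apply: idealZ.
have [a evca] := ev_surj ((ev c ^+ j)^-1).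
exists (a *: (c ^+ j *: f - b)); first exact: idealZ.
rewrite map_mpolyZ raddfB /= evb subr0 map_mpolyZ scalerA evca rmorphXn /=.
by rewrite mulVf ?expf_neq0 // scale1r.
Qed.

End Specialization.

(** * Nonvanishing of polynomials over a field of characteristic 0 *)

(** Digits in base [N] are determined by the number they represent. *)
Lemma digits_inj k N (u v : 'I_k -> nat) :
  (forall i, (u i < N)%N) -> (forall i, (v i < N)%N) ->
  (\sum_(i < k) u i * N ^ i = \sum_(i < k) v i * N ^ i)%N -> u =1 v.
Proof.
elim: k u v => [|k IHk] u v ltu ltv; first by move=> _ [].
have shift w : (\sum_(i < k.+1) w i * N ^ i =
    (\sum_(i < k) w (lift ord0 i) * N ^ i) * N + w ord0)%N.
  rewrite big_ord_recl expn0 muln1 addnC big_distrl; congr (_ + _)%N.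
  by apply: eq_bigr => i _; rewrite /= expnSr mulnA.
have N0 : (0 < N)%N := leq_ltn_trans (leq0n _) (ltu ord0).
rewrite !shift => E i.
have Emod : u ord0 = v ord0.
  by have := congr1 (modn^~ N) E; rewrite /= !modnMDl !modn_small.
have [j ->|->//] := unliftP ord0 i.
apply: (IHk (u \o lift ord0) (v \o lift ord0)) => [a|a|]; rewrite ?ltu ?ltv //=.
have := congr1 (divn^~ N) E.
by rewrite /= !divnMDl // !divn_small // !addn0.
Qed.

Lemma poly_nonroot (F : fieldType) (p : {poly F}) :
  injective (fun m : nat => m%:R : F) -> p != 0 -> exists x, p.[x] != 0.
Proof.
move=> inj_nat pn0; apply: contrapT => rootp.
pose rs : seq F := [seq m%:R | m <- iota 0 (size p)].
suff : (size rs < size p)%N by rewrite size_map size_iota ltnn.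
apply: max_poly_roots => //; last by rewrite map_inj_uniq ?iota_uniq.
by apply/allP => x _; apply: contraT => px; case: rootp; exists x.
Qed.

(** The Kronecker substitution, which sends the variable of index [i] to the power
    [N ^ i] of a single variable, separates the monomials of degree less than [N]. *)
Lemma mpoly_nonroot (F : fieldType) (k : nat) (p : {mpoly F[k]}) :
  injective (fun m : nat => m%:R : F) -> p != 0 -> exists q, p.@[q] != 0.
Proof.
move=> inj_nat pn0; pose N := msize p.
pose kron (m : 'X_{1..k}) := (\sum_(i < k) m i * N ^ i)%N.
pose P : {poly F} := \sum_(m <- msupp p) p@_m *: 'X^(kron m).
have digit m i : m \in msupp p -> (m i < N)%N.
  move=> /msize_mdeg_lt; apply: leq_ltn_trans.
  by rewrite mdegE (bigD1 i) //= leq_addr.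
have Pn0 : P != 0.
  have m0p := mlead_supp pn0; set m0 := mlead p in m0p.
  apply: contraTneq m0p => P0; rewrite -mcoeff_eq0.
  have := congr1 (fun Q : {poly F} => Q`_(kron m0)) P0; rewrite coef0 => <-.
  rewrite coef_sum (bigD1_seq m0) ?msupp_uniq ?mlead_supp //=.
  rewrite coefZ coefXn eqxx mulr1 big_seq_cond big1 ?addr0 // => m /andP[mp ne].
  rewrite coefZ coefXn; case: eqP => [E|_]; last by rewrite mulr0.
  case/eqP: ne; apply/mnmP; apply: (digits_inj (N := N)) => [i|i|].
  - exact: digit.
  - exact: digit (mlead_supp pn0).
  - by rewrite -/(kron m) -E.
have [x Px] := poly_nonroot inj_nat Pn0.
exists (fun i => x ^+ (N ^ i)); apply: contraNneq Px => p0; rewrite -p0.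
rewrite /P horner_sum mevalE; apply/eqP/eq_bigr => m _.
rewrite hornerZ hornerXn /kron expr_sum; congr (_ * _).
by apply: eq_bigr => i _; rewrite mulnC exprM.
Qed.

(** * Polynomials in x over the ring of polynomials in p *)

Section PolynomialsInX.
Variables (F : fieldType) (n k : nat).
Implicit Types (f g : {mpoly F[n + k]}) (m : 'X_{1..n + k}).

(** The exponents in x, and those in p. *)
Definition xpart m : 'X_{1..n} := [multinom m (lshift k i) | i < n].
Definition ppart m : 'X_{1..k} := [multinom m (rshift n j) | j < k].

(** The monomial with given exponents in x and in p. *)
Definition mjoin (a : 'X_{1..n}) (b : 'X_{1..k}) : 'X_{1..n + k} :=
  [multinom match split i with inl j => a j | inr j => b j end | i < n + k].

Lemma mjoinEl a b i : mjoin a b (lshift k i) = a i.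
Proof. by rewrite mnmE (unsplitK (inl i)). Qed.

Lemma mjoinEr a b j : mjoin a b (rshift n j) = b j.
Proof. by rewrite mnmE (unsplitK (inr j)). Qed.

Lemma mjoinK m : mjoin (xpart m) (ppart m) = m.
Proof.
by apply/mnmP => i; case: (split_ordP i) => j ->; rewrite ?mjoinEl ?mjoinEr mnmE.
Qed.

Lemma xpart_mjoin a b : xpart (mjoin a b) = a.
Proof. by apply/mnmP => i; rewrite mnmE mjoinEl. Qed.

Lemma ppart_mjoin a b : ppart (mjoin a b) = b.
Proof. by apply/mnmP => i; rewrite mnmE mjoinEr. Qed.

(** The variables x are larger than the variables p. *)
Lemma mlex_xpart m1 m2 : mlex_lt m1 m2 ->
  xpart m1 = xpart m2 \/ mlex_lt (xpart m1) (xpart m2).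
Proof.
case: (mlex_total (xpart m1) (xpart m2)) => [|->|]; [by right|by left|].
case/mlex_ltP => i eq21 lt21 /mlex_ltP[j eq12 lt12]; exfalso.
rewrite !mnmE in lt21; have [ij|ji] := ltnP (lshift k i) j.
  by rewrite (eq12 _ ij) ltnn in lt21.
have [j' jE|j' jE] := split_ordP j; last first.
  by move: ji; rewrite jE leqNgt (leq_trans (ltn_ord i)) //= leq_addr.
move: ji; rewrite leq_eqVlt => /predU1P[/val_inj ji|ji].
  by move: lt12; rewrite ltnNge ji ltnW.
rewrite jE in ji lt12; have := eq21 j' ji; rewrite !mnmE => E.
by rewrite E ltnn in lt12.
Qed.

Lemma mlex_xmon m a : mlex_lt (xpart m) a -> mlex_lt m (xmon k a).
Proof.
case/mlex_ltP=> i eqm ltm; apply/mlex_ltP; exists (lshift k i) => [j ltji|].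
  have [j' jE|j' jE] := split_ordP j; last first.
    by move: ltji; rewrite jE ltnNge /= (leq_trans (ltnW (ltn_ord i))) // leq_addr.
  by move: ltji; rewrite jE => /eqm; rewrite !mnmE (unsplitK (inl j')).
by move: ltm; rewrite !mnmE (unsplitK (inl i)).
Qed.

Lemma mmap1_split (S : comNzRingType) (u : 'I_n -> S) (v : 'I_k -> S) m :
  mmap1 (fun i => match split i with inl j => u j | inr j => v j end) m =
  mmap1 u (xpart m) * mmap1 v (ppart m).
Proof.
rewrite /mmap1 big_split_ord /=; congr (_ * _); apply: eq_bigr => i _.
  by rewrite (unsplitK (inl i)) mnmE.
by rewrite (unsplitK (inr i)) mnmE.
Qed.

Fact xpoly_key : unit. Proof. by []. Qed.

(** A polynomial in x and p, seen as a polynomial in x over [F[p]]. It is sealed,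
    since comparing two of its values by unfolding is very costly. *)
Definition xpoly : {mpoly F[n + k]} -> {mpoly {mpoly F[k]}[n]} :=
  locked_with xpoly_key (mmap (@mpolyC n {mpoly F[k]} \o @mpolyC k F)
    (fun i => match split i with inl j => 'X_j | inr j => ('X_j)%:MP end)).

Lemma xpolyE : xpoly = mmap (@mpolyC n {mpoly F[k]} \o @mpolyC k F)
  (fun i => match split i with inl j => 'X_j | inr j => ('X_j)%:MP end).
Proof. by rewrite /xpoly unlock. Qed.

Lemma xpoly_additive : additive xpoly.
Proof. rewrite xpolyE; exact: raddfB. Qed.

HB.instance Definition _ := GRing.isAdditive.Build
  {mpoly F[n + k]} {mpoly {mpoly F[k]}[n]} xpoly xpoly_additive.

Lemma xpoly_multiplicative : multiplicative xpoly.
Proof. rewrite xpolyE; exact: mmap_is_multiplicative. Qed.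

HB.instance Definition _ := GRing.isMultiplicative.Build
  {mpoly F[n + k]} {mpoly {mpoly F[k]}[n]} xpoly xpoly_multiplicative.

Lemma xpolyX m : xpoly 'X_[m] = 'X_[ppart m] *: 'X_[xpart m].
Proof.
rewrite xpolyE mmapX mmap1_split mmap1_id -mul_mpolyC mulrC; congr (_ * _).
rewrite -[in RHS]mmap1_id /mmap1 rmorph_prod; apply: eq_bigr => i _.
by rewrite rmorphXn.
Qed.

Lemma xpolyZ c f : xpoly (c *: f) = c%:MP *: xpoly f.
Proof. by rewrite xpolyE mmapZ mul_mpolyC. Qed.

Lemma mcoeff_xpoly f a b : (xpoly f)@_a@_b = f@_(mjoin a b).
Proof.
elim/mpolyind: f => [|c m f _ _ IHf]; first by rewrite raddf0 !mcoeff0.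
rewrite raddfD /= xpolyZ xpolyX !mcoeffD IHf; congr (_ + _).
rewrite !mcoeffZ !mcoeffX mcoeffCM; congr (_ * _).
have -> : (m == mjoin a b) = (xpart m == a) && (ppart m == b).
  apply/eqP/andP => [->|[/eqP<- /eqP<-]]; last by rewrite mjoinK.
  by rewrite xpart_mjoin ppart_mjoin.
case: (xpart m == a); last by rewrite mulr0 mcoeff0.
by rewrite mulr1 mcoeffX.
Qed.

Lemma xpoly_inj : injective xpoly.
Proof.
move=> f g fg; apply/mpolyP => m.
by rewrite -(mjoinK m) -!mcoeff_xpoly fg.
Qed.

Lemma xpoly_param c : xpoly (param_emb n c) = c%:MP.
Proof.
elim/mpolyind: c => [|c m p _ _ IHp]; first by rewrite /param_emb !raddf0.
rewrite /param_emb in IHp *; rewrite !raddfD /= IHp; congr (_ + _).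
rewrite mmapZ mmapX mul_mpolyC xpolyZ -!mul_mpolyC rmorphM; congr (_ * _).
rewrite -[in RHS]mmap1_id /mmap1 !rmorph_prod; apply: eq_bigr => i _ /=.
rewrite !rmorphXn /=; congr (_ ^+ _).
by rewrite xpolyE mmapX mmap1U (unsplitK (inr i)).
Qed.

Lemma xpoly_xmon a : xpoly 'X_[xmon k a] = 'X_[a].
Proof.
have -> : xmon k a = mjoin a 0%MM.
  by apply/mnmP => i; rewrite !mnmE; case: split => // j; rewrite mnm0E.
by rewrite xpolyX xpart_mjoin ppart_mjoin mpolyX0 scale1r.
Qed.

Lemma xpoly_surj P : exists f, xpoly f = P.
Proof.
exists (\sum_(a <- msupp P) param_emb n P@_a * 'X_[xmon k a]).
rewrite [RHS]mpolyE raddf_sum; apply: eq_bigr => a _ /=.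
by rewrite rmorphM /= xpoly_param xpoly_xmon mul_mpolyC.
Qed.

Lemma xpoly_ideal (I : set {mpoly F[n + k]}) : is_ideal I -> is_ideal (xpoly @` I).
Proof.
case=> I0 ID IM; split.
- by exists 0; rewrite ?raddf0.
- move=> _ _ [f If <-] [g Ig <-]; exists (f + g); first exact: ID.
  by rewrite raddfD.
- move=> a _ [f If <-]; have [b <-] := xpoly_surj a.
  by exists (b * f); [exact: IM|rewrite rmorphM].
Qed.

Lemma xpoly_eq0 f : (xpoly f == 0) = (f == 0).
Proof. by rewrite -(inj_eq xpoly_inj) raddf0. Qed.

Lemma msupp_xpoly f m : m \in msupp f -> xpart m \in msupp (xpoly f).
Proof.
rewrite !mcoeff_msupp; apply: contraNneq => f0.
by rewrite -(mjoinK m) -mcoeff_xpoly f0 mcoeff0.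
Qed.

Lemma lexlead_xpoly f : f != 0 -> lexlead (xpoly f) = xpart (lexlead f).
Proof.
move=> fn0; apply: lexlead_eq; first exact/msupp_xpoly/lexlead_msupp.
move=> a; rewrite mcoeff_msupp => fa.
have [b fab] : exists b, b \in msupp (xpoly f)@_a.
  by exists (lexlead (xpoly f)@_a); apply: lexlead_msupp.
have : mjoin a b \in msupp f by rewrite mcoeff_msupp -mcoeff_xpoly -mcoeff_msupp.
move=> /msupp_lexlead[<-|]; first by left; rewrite xpart_mjoin.
by move=> /mlex_xpart; rewrite xpart_mjoin.
Qed.

Lemma lexlead_xpoly_dvd f g : f != 0 -> g != 0 ->
  (lexlead g <= lexlead f)%MM -> (lexlead (xpoly g) <= lexlead (xpoly f))%MM.
Proof.
move=> fn0 gn0 /mnm_lepP le_gf; rewrite (lexlead_xpoly fn0) (lexlead_xpoly gn0).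
by apply/mnm_lepP => i; rewrite !mnmE.
Qed.

Lemma is_xlead_xpoly f : f != 0 ->
  is_xlead f (lexlc (xpoly f)) (lexlead (xpoly f)).
Proof.
rewrite -xpoly_eq0 => fn0; split; first exact: lexlc_neq0.
set c := lexlc _; set a := lexlead _.
exists (f - param_emb n c * 'X_[xmon k a]); split; first by rewrite addrC subrK.
move=> m /msupp_xpoly; rewrite rmorphB rmorphM /= xpoly_param xpoly_xmon mul_mpolyC.
move=> ma; apply: mlex_xmon; have /msuppB_le := ma; rewrite mem_cat => /orP[|].
  case/msupp_lexlead => // mE; move: ma.
  by rewrite mcoeff_msupp mcoeffB mcoeffZ mcoeffX mE eqxx mulr1 subrr eqxx.
move=> /msuppZ_le; rewrite msuppX inE => /eqP mE; move: ma.
by rewrite mcoeff_msupp mcoeffB mcoeffZ mcoeffX mE eqxx mulr1 subrr eqxx.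
Qed.

Lemma spec_xpoly (q : 'I_k -> F) f : spec q f = map_mpoly (meval q) (xpoly f).
Proof.
elim/mpolyind: f => [|c m f _ _ IHf]; first by rewrite /spec !raddf0.
rewrite /spec in IHf *; rewrite !raddfD /= IHf; congr (_ + _).
rewrite xpolyZ map_mpolyZ /= mevalC mmapZ mul_mpolyC mmapX xpolyX; congr (_ *: _).
rewrite map_mpolyZ map_mpolyX mmap1_split mmap1_id mulrC -mul_mpolyC.
rewrite /= mevalX rmorph_prod; congr (_ * _).
by apply: eq_bigr => i _; rewrite rmorphXn.
Qed.

End PolynomialsInX.

(** * Specialization of saturations and of their Groebner bases *)

Lemma saturation_ideal (R : comNzRingType) (I : set R) h :
  is_ideal I -> is_ideal (saturation I h).
Proof.
case=> I0 ID IM; split=> [|f g [l [l0 If]] [j [j0 Ig]]|a f [l [l0 If]]].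
- by exists 1%N; rewrite mul0r.
- exists (l + j)%N; rewrite addn_gt0 l0; split=> //.
  have -> : (f + g) * h ^+ (l + j) = h ^+ j * (f * h ^+ l) + h ^+ l * (g * h ^+ j).
    by rewrite mulrDl exprD; congr (_ + _); [rewrite mulrA mulrC|rewrite mulrCA].
  by apply: ID; apply: IM.
- by exists l; split=> //; rewrite -mulrA; apply: IM.
Qed.

(** Specialization of a Groebner basis of a saturation, over any field of
    characteristic 0, a condition expressed by the injectivity of the map from the
    natural numbers to the field. *)
Theorem groebner_specialization (F : fieldType) (n k : nat)
  (I : set {mpoly F[n + k]}) (h : {mpoly F[n + k]})
  (G : seq {mpoly F[n + k]})
  (HI : is_ideal I)
  (inj_nat : injective (fun m : nat => m%:R : F))
  (HG : is_groebner (saturation I h) G) :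
  exists D : set ('I_k -> F),
    is_subvariety D /\ D `<` [set: 'I_k -> F] /\
    forall q : 'I_k -> F, ~ D q ->
      [/\ is_groebner (saturation (spec q @` I) (spec q h))
            [seq spec q g | g <- G],
          forall g, g \in G ->
            exists (c : {mpoly F[k]}) (a : 'X_{1..n}),
              is_xlead g c a /\ c.@[q] != 0 &
          spec q @` saturation I h = saturation (spec q @` I) (spec q h)].
Proof.
(* The specialization, read through the domain structure of [F[p]] under which the
   general results on specialization apply. *)
pose A : idomainType := {mpoly F[k]}.
pose ev q : {rmorphism A -> F} := meval q.
have specX q f : @map_mpoly n A F (ev q) (xpoly f) = spec q f.
  by rewrite spec_xpoly.
pose S := saturation I h; pose SX := @xpoly F n k @` S.
have HS : is_ideal S := saturation_ideal h HI.
have HSX : is_ideal SX := xpoly_ideal HS.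
(* A saturation by h is stable under division by h. *)
have SXh f : SX (xpoly h * f) -> SX f.
  have [f' <-] := xpoly_surj f; rewrite -rmorphM => -[u [l [l0 Iu]]] /xpoly_inj uE.
  exists f' => //; exists l.+1; split=> //.
  by rewrite exprS mulrA (mulrC f') -uE.
have [c cn0 cP] := @generic_saturation n A SX _ HSX SXh.
case/is_groebnerP: HG => GS Glead.
pose e := c * \prod_(g <- G) lexlc (xpoly g).
have en0 : e != 0.
  rewrite mulf_neq0 // prodf_seq_neq0; apply/allP => g /GS[_ gn0].
  by rewrite implyTb lexlc_neq0 // xpoly_eq0.
exists [set q | e.@[q] = 0]; split; last split.
- exists [set e]; apply/seteqP; split=> q /=; first by move=> eq0 _ ->.
  by apply.
- split=> // subD; have [q /eqP] := mpoly_nonroot inj_nat en0; apply.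
  exact: (subD q).
move=> q /= /eqP; rewrite mevalM mulf_eq0 negb_or => /andP[evc evG].
have lcG g : g \in G -> (lexlc (xpoly g)).@[q] != 0.
  move=> gG; apply: contraNneq evG => lc0.
  by rewrite (big_rem g) //= mevalM lc0 mul0r.
have specE : spec q @` S = saturation (spec q @` I) (spec q h).
  apply/seteqP; split=> [_ [f [l [l0 If]] <-]|f' [l [l0 [u Iu uE]]]].
    exists l; split=> //; exists (f * h ^+ l) => //.
    by rewrite !spec_xpoly !rmorphM !rmorphXn.
  have [f fE] : exists f, spec q f = f'.
    have [f fE] := xpoly_surj (map_mpoly (@mpolyC k F) f').
    exists f; rewrite spec_xpoly fE; apply/mpolyP => m.
    by rewrite !mcoeff_map_mpoly /= mevalC.
  have Su : S u.
    by exists 1%N; split=> //; case: HI => _ _ IM; rewrite mulrC; apply: IM.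
  have [||_ [v Sv <-] vE] := cP _ (ev q) _ evc (xpoly f) l.
  - by move=> x; exists x%:MP; rewrite /= mevalC.
  - exists (xpoly u); first by exists u.
    by rewrite !specX fE uE.
  by exists v; rewrite // -specX vE specX.
split=> //; last first.
  move=> g gG; exists (lexlc (xpoly g)), (lexlead (xpoly g)).
  by split; [apply: is_xlead_xpoly; have [] := GS _ gG|exact: lcG].
rewrite -specE; apply/is_groebnerP; split=> [_ /mapP[g gG ->]|_ [f Sf <-]].
  split; first by exists g => //; have [] := GS _ gG.
  by rewrite -specX; apply: map_mpoly_neq0; apply: lcG.
rewrite -specX => evf.
have [|||_ /mapP[g gG ->] leg] := @specialized_leads n A SX
  [seq xpoly g | g <- G] F (ev q) HSX _ _ (xpoly f) _ evf.
- by move=> _ /mapP[g gG ->]; split; [exists g => //; have [] := GS _ gG|exact: lcG].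
- move=> _ [u Su <-]; rewrite xpoly_eq0 => un0; have [g gG leg] := Glead _ Su un0.
  exists (xpoly g); first exact: map_f.
  by have [_ gn0] := GS _ gG; apply: lexlead_xpoly_dvd.
- by exists f.
by exists (spec q g); [exact: map_f|rewrite -specX].
Qed.

Theorem lemma2p4 (R : realType) (n k : nat)
  (I : set {mpoly R[i][n + k]}) (h : {mpoly R[i][n + k]})
  (G : seq {mpoly R[i][n + k]})
  (HI : is_ideal I)
  (Hcap : saturation I h `&` range (@param_emb R[i] n k) = [set 0])
  (HG : is_groebner (saturation I h) G) :
  exists D : set ('I_k -> R[i]),
    is_subvariety D /\ D `<` [set: 'I_k -> R[i]] /\
    forall q : 'I_k -> R[i], ~ D q ->
      [/\ is_groebner (saturation (spec q @` I) (spec q h))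
            [seq spec q g | g <- G],
          forall g, g \in G ->
            exists (c : {mpoly R[i][k]}) (a : 'X_{1..n}),
              is_xlead g c a /\ c.@[q] != 0 &
          spec q @` saturation I h = saturation (spec q @` I) (spec q h)].
Proof.
by apply: groebner_specialization => // m1 m2 /eqP; rewrite Num.Theory.eqr_nat => /eqP.
Qed.
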